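(* Let $p\neq 0$, $q$ be integers and $n\ge 0$ an integer. Then \[ \sum_{j = 0}^n P_{q - pj} Q_{p(n - 2j)} = \frac{\begin{vmatrix} P_{pn + 3p + q} - P_{q - 2pn} & P_{3p - 3} & P_{3p - 4} \\ P_{pn + 3p + q + 1} - P_{q - 2pn + 1} & P_{3p - 2} - 1 & P_{3p - 3} \\ P_{pn + 3p + q - 1} - P_{q - 2pn - 1} & P_{3p - 4} & P_{3p - 5} - 1 \end{vmatrix}}{\begin{vmatrix} P_{3p - 2} - 1 & P_{3p - 3} & P_{3p - 4} \\ P_{3p - 1} & P_{3p - 2} - 1 & P_{3p - 3} \\ P_{3p - 3} & P_{3p - 4} & P_{3p - 5} - 1 \end{vmatrix}} +\frac{2\begin{vmatrix} P_{q + 1} P_{pn + p - 4} - P_q P_{pn + p - 3} & P_{p - 4} & 0 \\ P_{q + 2} P_{pn + p - 4} - P_{q + 1} P_{pn + p - 3} & - P_{p - 3} & P_{p - 4} \\ P_q P_{pn + p - 4} - P_{q - 1} P_{pn + p - 3} & 0 & - P_{p - 3} \end{vmatrix}}{\begin{vmatrix} - P_{p - 3} & P_{p - 4} & 0 \\ P_{p - 4} & - P_{p - 3} & P_{p - 4} \\ P_{p - 4} & 0 & - P_{p - 3} \end{vmatrix}}. \] In particular, $\sum_{j=0}^n P_{q-j}Q_{n-2j}=P_{n+q+2}-P_{q-2n-1}-2(P_{q+1}P_{n-3}-P_qP_{n-2})$.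
   Context: The Padovan numbers $P_n$ are defined for all integers $n$ by $P_0=P_1=P_2=1$ and $P_n=P_{n-2}+P_{n-3}$ for all integers $n$ (extended to negative indices via $P_n=P_{n+3}-P_{n+1}$). The Perrin numbers $Q_n$ are defined for all integers $n$ by $Q_0=3$, $Q_1=0$, $Q_2=2$ and $Q_n=Q_{n-2}+Q_{n-3}$ for all integers $n$. *)

(* Defs.v *)
From mathcomp Require Import all_boot all_order all_algebra.

Set Implicit Arguments.
Unset Strict Implicit.
Unset Printing Implicit Defensive.

Import GRing.Theory.
Local Open Scope ring_scope.

(* A state is a window (u_n, u_(n+1), u_(n+2)) of a sequence satisfying
   u_(n+3) = u_(n+1) + u_n; the backward step uses u_(n-1) = u_(n+2) - u_n. *)
Definition window_next (s : int * int * int) : int * int * int :=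
  let: (a, b, c) := s in (b, c, b + a).

Definition window_prev (s : int * int * int) : int * int * int :=
  let: (a, b, c) := s in (c - a, a, b).

Definition window_at (s : int * int * int) (n : int) : int * int * int :=
  match n with
  | Posz k => iter k window_next s
  | Negz k => iter k.+1 window_prev s
  end.

Definition padovan (n : int) : int := (window_at (1, 1, 1) n).1.1.

Definition perrin (n : int) : int := (window_at (3, 0, 2) n).1.1.

Definition mx3 (R : Type) (a00 a01 a02 a10 a11 a12 a20 a21 a22 : R) : 'M[R]_3 :=
  \matrix_(i < 3, j < 3)
    nth a00 (nth [::] [:: [:: a00; a01; a02];
                          [:: a10; a11; a12];
                          [:: a20; a21; a22]] i) j.

Lemma window_prevK : cancel window_prev window_next.
Proof. by case=> [[a b] c]; rewrite /window_next /window_prev addrC subrK. Qed.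

Lemma window_atS (s : int * int * int) (n : int) :
  window_at s (n + 1) = window_next (window_at s n).
Proof.
case: n => [k | [|k]]; first by rewrite -PoszD addn1.
  by rewrite [LHS]/= window_prevK.
have -> : Negz k.+1 + 1 = Negz k by rewrite !NegzE -[k.+2]addn1 PoszD opprD subrK.
by rewrite [RHS]/= window_prevK.
Qed.

Lemma window_at_rec (s : int * int * int) (n : int) :
  (window_at s n).1.1 = (window_at s (n - 2)).1.1 + (window_at s (n - 3)).1.1.
Proof.
have -> : n - 2 = n - 3 + 1 by rewrite -addrA.
rewrite -[in LHS](subrK 3 n) -[X in _ - 3 + X]/(1 + 1 + 1 : int) !addrA.
by rewrite !window_atS; case: (window_at s (n - 3)) => [[a b] c].
Qed.

Lemma padovan_init : [/\ padovan 0 = 1, padovan 1 = 1 & padovan 2 = 1].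
Proof. by []. Qed.

Lemma padovan_rec (n : int) : padovan n = padovan (n - 2) + padovan (n - 3).
Proof. exact: window_at_rec. Qed.

Lemma perrin_init : [/\ perrin 0 = 3, perrin 1 = 0 & perrin 2 = 2].
Proof. by []. Qed.

Lemma perrin_rec (n : int) : perrin n = perrin (n - 2) + perrin (n - 3).
Proof. exact: window_at_rec. Qed.

(* Main.v *)
(* Let x be the root of x^3 = x + 1, so that padovan n = sum_i c_i x_i^n and
   perrin n = sum_k x_k^n over the three conjugates of x. In the sum, the terms
   with i = k give the geometric sum of padovan (q + pn - 3pj), which telescopes
   after multiplication by the norm of x^(3p) - 1: this is the first quotient.
   Since x1 x2 x3 = 1, the terms with k <> i give twice
   sum_i c_i x_i^q h_n(x_k^p, x_l^p), where k, l are the other two indices and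
   h_n is the complete homogeneous symmetric polynomial: this is the second
   quotient. The denominators are nonzero because the norm form of
   Z[x]/(x^3 - x - 1) is anisotropic (already modulo 2) and x^m <> 1 for
   m <> 0. *)

Require Import Defs.
From mathcomp Require Import all_boot all_order all_algebra.
From mathcomp Require Import ring zify.

Import GRing.Theory Num.Theory.
Local Open Scope ring_scope.

(** * Sequences satisfying the Padovan recurrence on all integers *)

Definition padovan_like (u : int -> int) : Prop :=
  forall k, u (k + 3) = u (k + 1) + u k.

Lemma padovan_likeP (u : int -> int) :
  (forall k, u k = u (k - 2) + u (k - 3)) -> padovan_like u.
Proof. by move=> h k; rewrite h; congr (u _ + u _); ring. Qed.

Lemma padovan_padovan_like : padovan_like padovan.
Proof. exact/padovan_likeP/padovan_rec. Qed.

Lemma perrin_padovan_like : padovan_like perrin.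
Proof. exact/padovan_likeP/perrin_rec. Qed.

Lemma int_two_sided_ind (R : int -> Prop) :
  R 0 -> (forall m, R m -> R (m + 1)) -> (forall m, R m -> R (m - 1)) ->
  forall m, R m.
Proof.
move=> R0 Rs Rp; elim/int_rec=> // n.
  by move/Rs; rewrite intS addrC.
by move/Rp; rewrite intS opprD addrC.
Qed.

(** * Powers of x and their action as shifts *)

(* In Z[x]/(x^3 - x - 1) one has x^m = a + b x + c x^2 with a = px0 m,
   b = px1 m, c = px2 m. *)
Definition px0 (m : int) : int := padovan (m - 5).
Definition px1 (m : int) : int := padovan (m - 3).
Definition px2 (m : int) : int := padovan (m - 4).

Lemma px_succ (m : int) :
  [/\ px0 (m + 1) = px2 m, px1 (m + 1) = px0 m + px2 m & px2 (m + 1) = px1 m].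
Proof.
rewrite /px0 /px1 /px2; split.
- by congr padovan; ring.
- rewrite (_ : m + 1 - 3 = m - 5 + 3); last by ring.
  rewrite padovan_padovan_like addrC; congr (_ + padovan _); ring.
- by congr padovan; ring.
Qed.

(** The ring Z[x]/(x^3 - x - 1) acts on such sequences with x as the shift by one, so x^m acts as
    the shift by m. *)
Lemma padovan_like_shift (u : int -> int) (m k : int) : padovan_like u ->
  u (k + m) = px0 m * u k + px1 m * u (k + 1) + px2 m * u (k + 2).
Proof.
move=> hu; elim/int_two_sided_ind: m k => [k|m IH k|m IH k].
- rewrite [px0 0](_ : _ = 1) // [px1 0](_ : _ = 0) // [px2 0](_ : _ = 0) //.
  by rewrite addr0; ring.
- have [-> -> ->] := px_succ m.
  rewrite (_ : k + (m + 1) = k + 1 + m); last by ring.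
  rewrite IH (_ : k + 1 + 1 = k + 2); last by ring.
  rewrite (_ : k + 1 + 2 = k + 3); last by ring.
  by rewrite hu; ring.
- have := px_succ (m - 1); rewrite subrK => -[e0 e1 e2].
  rewrite (_ : k + (m - 1) = k - 1 + m); last by ring.
  have := hu (k - 1).
  rewrite IH e0 e1 e2 subrK.
  rewrite (_ : k - 1 + 3 = k + 2); last by ring.
  rewrite (_ : k - 1 + 2 = k + 1); last by ring.
  by move=> ->; ring.
Qed.

(** This is the product x^m x^p in coordinates; each coordinate is itself a translated Padovan
    sequence, so the shift formula applies to it. *)
Lemma px_add (m p : int) :
  [/\ px0 (m + p) = px0 p * px0 m + px1 p * px2 m + px2 p * px1 m,
      px1 (m + p) = px0 p * px1 m + px1 p * (px0 m + px2 m)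
                    + px2 p * (px1 m + px2 m)
    & px2 (m + p) = px0 p * px2 m + px1 p * px1 m + px2 p * (px0 m + px2 m)].
Proof.
have hP := padovan_padovan_like.
have [_ e1 _] := px_succ m.
have e2 : padovan (m - 1) = px1 m + px2 m.
  rewrite (_ : m - 1 = m - 4 + 3); last by ring.
  by rewrite hP /px1 /px2; congr (padovan _ + _); ring.
split.
- rewrite {1}/px0 (_ : m + p - 5 = m - 5 + p); last by ring.
  by rewrite (padovan_like_shift _ _ _ hP); congr (_ + _ * padovan _ + _ * padovan _); ring.
- rewrite {1}/px1 (_ : m + p - 3 = m - 3 + p); last by ring.
  rewrite (padovan_like_shift _ _ _ hP) -e1 -e2.
  by congr (_ + _ * padovan _ + _ * padovan _); ring.
- rewrite {1}/px2 (_ : m + p - 4 = m - 4 + p); last by ring.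
  rewrite (padovan_like_shift _ _ _ hP) -e1.
  by congr (_ + _ * padovan _ + _ * padovan _); ring.
Qed.

(** * The norm form and its anisotropy *)

Definition inv0 (a b c : int) : int := (a + c) ^+ 2 - b * (b + c).
Definition inv1 (a b c : int) : int := c * (b + c) - b * (a + c).
Definition inv2 (a b c : int) : int := b ^+ 2 - c * (a + c).

(* The norm of a + b x + c x^2 in Z[x]/(x^3 - x - 1); the adjugate
   inv0 + inv1 x + inv2 x^2 is the norm times the inverse. *)
Definition norm3 (a b c : int) : int :=
  a * inv0 a b c + c * inv1 a b c + b * inv2 a b c.

Lemma norm3_px (m : int) : norm3 (px0 m) (px1 m) (px2 m) = 1.
Proof.
have hs k : norm3 (px0 (k + 1)) (px1 (k + 1)) (px2 (k + 1))
          = norm3 (px0 k) (px1 k) (px2 k).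
  by have [-> -> ->] := px_succ k; rewrite /norm3 /inv0 /inv1 /inv2; ring.
elim/int_two_sided_ind: m => // m IH; first by rewrite hs.
by rewrite -hs subrK.
Qed.

(** Since x^3 - x - 1 is irreducible modulo 2, the form reduces to the norm of the field with 8
    elements, which vanishes only at 0. *)
Lemma norm3_eq0_even (a b c : int) :
  norm3 a b c = 0 -> exists a' b' c', [/\ a = 2 * a', b = 2 * b' & c = 2 * c'].
Proof.
have par (x : int) : exists y, x = 2 * y \/ x = 2 * y + 1.
  by exists (divz x 2); lia.
rewrite /norm3 /inv0 /inv1 /inv2.
have [a' ha] := par a; have [b' hb] := par b; have [c' hc] := par c.
move=> h; exists a', b', c'.
by case: ha hb hc h => -> [] -> [] ->; move=> h; split=> //; exfalso; lia.
Qed.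

(** Infinite descent: halving all coordinates divides this cubic form by 8. *)
Lemma norm3_eq0 (a b c : int) :
  norm3 a b c = 0 -> [/\ a = 0, b = 0 & c = 0].
Proof.
have [n] := ubnP (absz a + absz b + absz c)%N.
elim: n a b c => // n IH a b c hn h.
have [a' [b' [c' [ea eb ec]]]] := norm3_eq0_even a b c h.
have h' : norm3 a' b' c' = 0.
  have : 8 * norm3 a' b' c' = 0.
    by rewrite -h ea eb ec /norm3 /inv0 /inv1 /inv2; ring.
  lia.
have [z|nz] := posnP (absz a + absz b + absz c)%N; first by split; lia.
have [] := IH a' b' c' _ h'; first by lia.
by rewrite ea eb ec => -> -> ->.
Qed.

(** * No nontrivial power of x equals 1 *)

Lemma padovan_ge2 (n : nat) : 2 <= padovan (n%:Z + 3).
Proof.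
suff: [/\ 2 <= padovan (n%:Z + 3), 2 <= padovan (n%:Z + 4)
        & 2 <= padovan (n%:Z + 5)] by case.
elim: n => // n [h3 h4 h5].
rewrite intS (_ : 1 + n%:Z + 3 = n%:Z + 4); last by ring.
rewrite (_ : 1 + n%:Z + 4 = n%:Z + 5); last by ring.
rewrite (_ : 1 + n%:Z + 5 = n%:Z + 3 + 3); last by ring.
rewrite padovan_padovan_like (_ : n%:Z + 3 + 1 = n%:Z + 4); last by ring.
by split=> //; lia.
Qed.

Lemma padovan_aperiodic (r : int) :
  (forall k, padovan (k + r) = padovan k) -> r = 0.
Proof.
have pos (d : nat) : (forall k, padovan (k + d.+1%:Z) = padovan k) -> False.
  (* Three periods lead from index 0, with value 1, to index 3d + 3, with value at least 2. *)
  move=> hd; have := padovan_ge2 (3 * d)%N.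
  have := hd 0; rewrite -hd -hd.
  rewrite (_ : 0 + _ + _ + _ = (3 * d)%N%:Z + 3); last by lia.
  by move=> ->.
case: r => [[|d] //|d] h; exfalso; apply: (pos d) => // k.
by rewrite -(h (k + _)) NegzE addrK.
Qed.

Lemma px_eq_one (m : int) : px0 m = 1 -> px1 m = 0 -> px2 m = 0 -> m = 0.
Proof.
move=> e0 e1 e2; apply: padovan_aperiodic => k.
by rewrite (padovan_like_shift _ _ _ padovan_padovan_like) e0 e1 e2; ring.
Qed.

(** * Determinants, traces and Cayley-Hamilton *)

Lemma det_mx3 (a00 a01 a02 a10 a11 a12 a20 a21 a22 : int) :
  \det (mx3 a00 a01 a02 a10 a11 a12 a20 a21 a22)
  = a00 * (a11 * a22 - a12 * a21) - a10 * (a01 * a22 - a02 * a21)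
    + a20 * (a01 * a12 - a02 * a11).
Proof.
rewrite (expand_det_col _ ord0) !big_ord_recl big_ord0 /cofactor.
rewrite !(expand_det_col _ ord0) !big_ord_recl !big_ord0 /cofactor.
rewrite !det_mx11 !mxE /=.
ring.
Qed.

(** Everything is expressed in the window at [k], so iterated shifts become polynomial identities
    for [ring]. *)
Lemma padovan_like_shift3 (u : int -> int) (m k : int) : padovan_like u ->
  [/\ u (k + m) = px0 m * u k + px1 m * u (k + 1) + px2 m * u (k + 2),
      u (k + m + 1) = px0 m * u (k + 1) + px1 m * u (k + 2)
                      + px2 m * (u (k + 1) + u k)
    & u (k + m + 2) = px0 m * u (k + 2) + px1 m * (u (k + 1) + u k)
                      + px2 m * (u (k + 2) + u (k + 1))].
Proof.
move=> hu; have sh := padovan_like_shift _ m _ hu.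
split; first exact: sh.
- rewrite addrAC sh -hu.
  by congr (_ + _ * u _ + _ * u _); ring.
- have e : u (k + 2) + u (k + 1) = u (k + 1 + 3).
    by rewrite hu; congr (u _ + _); ring.
  rewrite addrAC sh -hu e.
  by congr (_ + _ * u _ + _ * u _); ring.
Qed.

(** [perrin m] is the trace of x^m, and 1, x, x^2 have traces 3, 0, 2. *)
Lemma perrin_px (m : int) : perrin m = 3 * px0 m + 2 * px2 m.
Proof.
rewrite -[in LHS](add0r m) (padovan_like_shift _ _ _ perrin_padovan_like).
by rewrite !add0r [perrin 0](_ : _ = 3) // [perrin 1](_ : _ = 0) //
           [perrin 2](_ : _ = 2) //; ring.
Qed.

(** As x^m has norm 1, its inverse is its adjugate, whose trace is taken here. *)
Lemma perrin_opp_px (m : int) :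
  perrin (- m) = 3 * inv0 (px0 m) (px1 m) (px2 m)
                 + 2 * inv2 (px0 m) (px1 m) (px2 m).
Proof.
have := norm3_px m; have [] := px_add (- m) m; rewrite addNr perrin_px.
rewrite [px0 0](_ : _ = 1) // [px1 0](_ : _ = 0) // [px2 0](_ : _ = 0) //.
set a := px0 m; set b := px1 m; set c := px2 m.
set d := px0 (- m); set e := px1 (- m); set f := px2 (- m) => h0 h1 h2 hN.
have -> : d = inv0 a b c.
  rewrite -[LHS]mulr1 -hN.
  (* Cramer's rule for x^(-m) x^m = 1, a linear system in [d], [e], [f]: the three multipliers are
     cofactors. *)
  transitivity (inv0 a b c * (a * d + b * f + c * e)
    + (b ^+ 2 - c * (a + c)) * (a * e + b * (d + f) + c * (e + f))
    + (c * (b + c) - b * (a + c)) * (a * f + b * e + c * (d + f))).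
    by rewrite /norm3 /inv0 /inv1 /inv2; ring.
  by rewrite -h0 -h1 -h2; ring.
have -> // : f = inv2 a b c.
rewrite -[LHS]mulr1 -hN.
transitivity (inv2 a b c * (a * d + b * f + c * e)
  + (c ^+ 2 - a * b) * (a * e + b * (d + f) + c * (e + f))
  + (a * (a + c) - b * c) * (a * f + b * e + c * (d + f))).
  by rewrite /norm3 /inv0 /inv1 /inv2; ring.
by rewrite -h0 -h1 -h2; ring.
Qed.

(* Cayley-Hamilton for multiplication by x^m, whose trace is perrin m and whose
   norm is 1. *)
Lemma padovan_like_charpoly (u : int -> int) (m r : int) : padovan_like u ->
  u (r + 3 * m) - perrin m * u (r + 2 * m) + perrin (- m) * u (r + m) = u r.
Proof.
move=> hu; rewrite -[RHS]mul1r -[X in X * u r](norm3_px m) perrin_opp_px perrin_px.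
rewrite (_ : r + 3 * m = r + m + m + m); last by ring.
rewrite (_ : r + 2 * m = r + m + m); last by ring.
have [-> _ _] := padovan_like_shift3 u m (r + m + m) hu.
have [-> -> ->] := padovan_like_shift3 u m (r + m) hu.
have [-> -> ->] := padovan_like_shift3 u m r hu.
rewrite /norm3 /inv0 /inv1 /inv2; ring.
Qed.

(** * The second quotient *)

(** With b, c the coordinates [px1], [px2] at [p], and b', c' those at [m + p], this applies c' x -
    b' times b^2 + b c x + c^2 x^(-1), the adjugate of b - c x, to [padovan] at [q]. A free [m]
    allows the value [- p]. *)
Definition num2 (p q m : int) : int :=
  let z0 := padovan (q + 1) * px2 (m + p) - padovan q * px1 (m + p) in
  let z1 := padovan (q + 2) * px2 (m + p) - padovan (q + 1) * px1 (m + p) in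
  let z2 := padovan q * px2 (m + p) - padovan (q - 1) * px1 (m + p) in
  px1 p ^+ 2 * z0 + px1 p * px2 p * z1 + px2 p ^+ 2 * z2.

(** Since x_k + x_l = -x_i, one has x_k^p - x_l^p = (x_k - x_l)(b - c x_i) with b = [px1 p], c =
    [px2 p]. This is minus the norm of b - c x. *)
Definition den2 (p : int) : int := norm3 0 (- px1 p) (px2 p).

Lemma padovan_pred (q : int) : padovan (q - 1) = padovan (q + 2) - padovan q.
Proof.
rewrite (_ : q + 2 = q - 1 + 3); last by ring.
by rewrite padovan_padovan_like subrK; ring.
Qed.

Lemma num2_0 (p q : int) : num2 p q 0 = den2 p * padovan q.
Proof.
rewrite /num2 /den2 add0r padovan_pred /norm3 /inv0 /inv1 /inv2; ring.
Qed.

Lemma num2_opp (p q : int) : num2 p q (- p) = 0.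
Proof.
rewrite /num2 addNr [px1 0](_ : _ = 0) // [px2 0](_ : _ = 0) //; ring.
Qed.

(* With m = p n, num2 p q m / den2 p is sum_i c_i x_i^q h_n(y_k, y_l) for
   y = x^p, so this is h_(n+2)(y, z) = y^(n+2) + z^(n+2) + y z h_n(y, z). *)
Lemma num2_step (p q m : int) :
  num2 p (q + p) (m + 2 * p) =
  num2 p q m
  + den2 p * (padovan (q + p) * perrin (m + 2 * p) - padovan (q + p + (m + 2 * p))).
Proof.
have hP := padovan_padovan_like.
rewrite -[num2 p q m]mul1r -[X in X * num2 p q m](norm3_px p) perrin_px /num2 !padovan_pred.
rewrite (_ : q + p + (m + 2 * p) = q + (m + 2 * p + p)); last by ring.
rewrite (_ : m + 2 * p = m + p + p); last by ring.
have [-> _ _] := padovan_like_shift3 _ (m + p + p + p) q hP.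
have [-> -> ->] := padovan_like_shift3 _ p q hP.
have [-> -> ->] := px_add (m + p + p) p.
have [-> -> ->] := px_add (m + p) p.
have [-> -> ->] := px_add m p.
by rewrite /den2 /norm3 /inv0 /inv1 /inv2; ring.
Qed.

(** The subtracted value is the i = k part of the product, as x^(q - pj) x^(p(n - 2j)) = x^(q + pn -
    3pj). *)
Definition cross_sum (p q : int) (n : nat) : int :=
  \sum_(0 <= j < n.+1)
    (padovan (q - p * j%:Z) * perrin (p * (n%:Z - 2 * j%:Z))
     - padovan (q + p * n%:Z - 3 * p * j%:Z)).

(* The two sides are the last and first terms of cross_sum, with m = p n. *)
Lemma cross_term_sym (q m : int) :
  padovan (q - m) * perrin (- m) - padovan (q - 2 * m)
  = padovan q * perrin m - padovan (q + m).
Proof.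
have := padovan_like_charpoly _ m (q - 2 * m) padovan_padovan_like.
rewrite (_ : q - 2 * m + 3 * m = q + m); last by ring.
rewrite (_ : q - 2 * m + 2 * m = q); last by ring.
rewrite (_ : q - 2 * m + m = q - m); last by ring.
by move=> <-; ring.
Qed.

(** Reindexing j as j + 1 identifies the inner terms with [cross_sum p q n]; the two outer terms are
    equal by symmetry, whence the factor 2. *)
Lemma cross_sumSS (p q : int) (n : nat) :
  cross_sum p (q + p) n.+2 =
  cross_sum p q n
  + 2 * (padovan (q + p) * perrin (p * n%:Z + 2 * p)
         - padovan (q + p + (p * n%:Z + 2 * p))).
Proof.
rewrite /cross_sum big_nat_recl // big_nat_recr //=.
have -> : \sum_(0 <= j < n.+1)
    (padovan (q + p - p * j.+1%:Z) * perrin (p * (n.+2%:Z - 2 * j.+1%:Z))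
     - padovan (q + p + p * n.+2%:Z - 3 * p * j.+1%:Z)) =
  \sum_(0 <= j < n.+1)
    (padovan (q - p * j%:Z) * perrin (p * (n%:Z - 2 * j%:Z))
     - padovan (q + p * n%:Z - 3 * p * j%:Z)).
  apply: eq_bigr => j _.
  by congr (padovan _ * perrin _ - padovan _); rewrite !intS; ring.
set m := p * n%:Z + 2 * p.
have := cross_term_sym (q + p) m.
rewrite (_ : q + p - m = q + p - p * n.+2%:Z); last by rewrite /m !intS; ring.
rewrite (_ : - m = p * (n.+2%:Z - 2 * n.+2%:Z)); last by rewrite /m !intS; ring.
rewrite (_ : q + p - 2 * m = q + p + p * n.+2%:Z - 3 * p * n.+2%:Z);
  last by rewrite /m !intS; ring.
move=> ->.
rewrite (_ : q + p - p * 0%:Z = q + p); last by ring.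
rewrite (_ : p * (n.+2%:Z - 2 * 0%:Z) = m); last by rewrite /m !intS; ring.
rewrite (_ : q + p + p * n.+2%:Z - 3 * p * 0%:Z = q + p + m);
  last by rewrite /m !intS; ring.
by ring.
Qed.

Lemma cross_sumE (p q : int) (n : nat) :
  den2 p * cross_sum p q n = 2 * num2 p q (p * n%:Z).
Proof.
(* The recurrence advances [n] by two and moves [q], so two consecutive cases are carried, each for
   all [q]. *)
have [h _] : (forall q, den2 p * cross_sum p q n = 2 * num2 p q (p * n%:Z))
  /\ (forall q, den2 p * cross_sum p q n.+1 = 2 * num2 p q (p * n.+1%:Z)); last exact: h.
elim: n {q} => [|n [IH0 IH1]]; split=> // q.
- have -> : cross_sum p q 0 = padovan q * perrin 0 - padovan q.
    by rewrite /cross_sum big_nat1; congr (padovan _ * perrin _ - padovan _); ring.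
  by rewrite mulr0 num2_0 [perrin 0](_ : _ = 3) //; ring.
- have -> : cross_sum p q 1 = 2 * (padovan q * perrin p - padovan (q + p)).
    rewrite (_ : 2 * _ = padovan q * perrin p - padovan (q + p)
      + (padovan (q - p) * perrin (- p) - padovan (q - 2 * p))).
      rewrite /cross_sum big_nat_recr //= big_nat1.
      by congr (padovan _ * perrin _ - padovan _
                + (padovan _ * perrin _ - padovan _)); ring.
    by rewrite cross_term_sym; ring.
  (* The odd base case is the step out of m = -p, where h_(-1) = 0. *)
  have := num2_step p (q - p) (- p); rewrite num2_opp subrK.
  rewrite (_ : - p + 2 * p = p); last by ring.
  by rewrite mulr1 => ->; ring.
- rewrite -(subrK p q) cross_sumSS mulrDr IH0.
  rewrite (_ : p * n.+2%:Z = p * n%:Z + 2 * p); last by rewrite !intS; ring.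
  by rewrite num2_step; ring.
Qed.

(** * The first quotient *)

(** The first column is left free because linearity in it lets the determinant pass through the sum
    over j. *)
Definition num1 (p z0 z1 z2 : int) : int :=
  \det (mx3 z0 (padovan (3 * p - 3)) (padovan (3 * p - 4))
            z1 (padovan (3 * p - 2) - 1) (padovan (3 * p - 3))
            z2 (padovan (3 * p - 4)) (padovan (3 * p - 5) - 1)).

Definition den1 (p : int) : int :=
  norm3 (px0 (3 * p) - 1) (px1 (3 * p)) (px2 (3 * p)).

Lemma padovan_m2 (m : int) : padovan (m - 2) = px0 m + px2 m.
Proof.
by have [_ <- _] := px_succ m; congr padovan; ring.
Qed.

Lemma padovan_m1 (m : int) : padovan (m - 1) = px1 m + px2 m.
Proof.
rewrite (_ : m - 1 = m - 4 + 3); last by ring.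
by rewrite padovan_padovan_like /px1 /px2; congr (padovan _ + _); ring.
Qed.

(** Cramer's rule: the matrix of the first denominator is x^(3p) - 1 acting on the values at s, s +
    1, s - 1, and the unknown solved for is the value at s. *)
Lemma num1_shift (p s : int) :
  num1 p (padovan (s + 3 * p) - padovan s)
         (padovan (s + 3 * p + 1) - padovan (s + 1))
         (padovan (s + 3 * p - 1) - padovan (s - 1))
  = den1 p * padovan s.
Proof.
have hP := padovan_padovan_like.
rewrite /num1 /den1 det_mx3 padovan_m2 -/(px0 _) -/(px1 _) -/(px2 _).
rewrite !padovan_pred.
move: (3 * p) => r.
have [-> -> ->] := padovan_like_shift3 _ r s hP.
by rewrite /norm3 /inv0 /inv1 /inv2; ring.
Qed.

Lemma num1_sum (p q : int) (n : nat) :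
  num1 p (padovan (p * n%:Z + 3 * p + q) - padovan (q - 2 * p * n%:Z))
         (padovan (p * n%:Z + 3 * p + q + 1) - padovan (q - 2 * p * n%:Z + 1))
         (padovan (p * n%:Z + 3 * p + q - 1) - padovan (q - 2 * p * n%:Z - 1))
  = den1 p * \sum_(0 <= j < n.+1) padovan (q + p * n%:Z - 3 * p * j%:Z).
Proof.
(* The offsets d = 0, 1, -1 give the three entries of the first column, each telescoping in steps of
   3p. *)
have tel (d : int) :
    padovan (p * n%:Z + 3 * p + q + d) - padovan (q - 2 * p * n%:Z + d) =
    \sum_(0 <= j < n.+1)
      (padovan (q + p * n%:Z - 3 * p * j%:Z + 3 * p + d)
       - padovan (q + p * n%:Z - 3 * p * j%:Z + d)).
  pose f (j : nat) := padovan (q + p * n%:Z - 3 * p * j%:Z + 3 * p + d).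
  transitivity (f 0%N - f n.+1).
    by congr (padovan _ - padovan _); rewrite ?intS; ring.
  rewrite -opprB -(@telescope_sumr _ 0%N n.+1 f isT) -sumrN.
  apply: eq_bigr => j _; rewrite opprB /f.
  by congr (_ - padovan _); rewrite intS; ring.
have := tel 0; have := tel 1; have := tel (- 1).
rewrite !addr0 => -> -> ->.
rewrite mulr_sumr; under [RHS]eq_bigr => j _ do rewrite -num1_shift.
rewrite /num1 det_mx3; under [RHS]eq_bigr => j _ do rewrite det_mx3.
rewrite !mulr_suml -!sumrB -big_split /=.
by apply: eq_bigr => j _; rewrite !addr0.
Qed.

(** * Nonzero denominators and the final formulas *)

Lemma den1_neq0 (p : int) : p != 0 -> den1 p != 0.
Proof.
move=> p0; apply/eqP => /norm3_eq0[/eqP]; rewrite subr_eq0 => /eqP e0 e1 e2.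
have := px_eq_one _ e0 e1 e2; lia.
Qed.

(** If it vanished, x^p would be an integer whose cube is its norm 1, hence x^p = 1. *)
Lemma den2_neq0 (p : int) : p != 0 -> den2 p != 0.
Proof.
move=> p0; apply/eqP => /norm3_eq0[_ /eqP]; rewrite oppr_eq0 => /eqP e1 e2.
have : px0 p ^+ 3 = 1.
  by rewrite -(norm3_px p) e1 e2 /norm3 /inv0 /inv1 /inv2; ring.
move=> h; have e0 : px0 p = 1 by nia.
have := px_eq_one _ e0 e1 e2; lia.
Qed.

Lemma sum_padovan_perrin_split (p q : int) (n : nat) :
  \sum_(0 <= j < n.+1)
    padovan (q - p * j%:Z) * perrin (p * (n%:Z - 2 * j%:Z))
  = \sum_(0 <= j < n.+1) padovan (q + p * n%:Z - 3 * p * j%:Z)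
    + cross_sum p q n.
Proof.
by rewrite /cross_sum -big_split /=; apply: eq_bigr => j _; rewrite addrC subrK.
Qed.

Lemma det_den1 (p : int) :
  \det (mx3
    (padovan (3 * p - 2) - 1) (padovan (3 * p - 3)) (padovan (3 * p - 4))
    (padovan (3 * p - 1)) (padovan (3 * p - 2) - 1) (padovan (3 * p - 3))
    (padovan (3 * p - 3)) (padovan (3 * p - 4)) (padovan (3 * p - 5) - 1))
  = den1 p.
Proof.
rewrite det_mx3 padovan_m2 padovan_m1 -/(px0 _) -/(px1 _) -/(px2 _).
by rewrite /den1 /norm3 /inv0 /inv1 /inv2; ring.
Qed.

Lemma det_den2 (p : int) :
  \det (mx3
    (- padovan (p - 3)) (padovan (p - 4)) 0
    (padovan (p - 4)) (- padovan (p - 3)) (padovan (p - 4))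
    (padovan (p - 4)) 0 (- padovan (p - 3)))
  = den2 p.
Proof.
rewrite det_mx3 -/(px1 _) -/(px2 _).
by rewrite /den2 /norm3 /inv0 /inv1 /inv2; ring.
Qed.

Lemma det_num2 (p q m : int) :
  \det (mx3
    (padovan (q + 1) * padovan (m + p - 4) - padovan q * padovan (m + p - 3))
      (padovan (p - 4)) 0
    (padovan (q + 2) * padovan (m + p - 4)
       - padovan (q + 1) * padovan (m + p - 3))
      (- padovan (p - 3)) (padovan (p - 4))
    (padovan q * padovan (m + p - 4) - padovan (q - 1) * padovan (m + p - 3))
      0 (- padovan (p - 3)))
  = num2 p q m.
Proof. by rewrite det_mx3 -/(px1 _) -/(px2 _) /num2 /px1 /px2; ring. Qed.

Theorem theorem13 :
  (forall (p q : int) (n : nat), p != 0 ->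
     let P := padovan in
     let Q := perrin in
     let N1 := \det (mx3
       (P (p * n%:Z + 3 * p + q) - P (q - 2 * p * n%:Z))
         (P (3 * p - 3)) (P (3 * p - 4))
       (P (p * n%:Z + 3 * p + q + 1) - P (q - 2 * p * n%:Z + 1))
         (P (3 * p - 2) - 1) (P (3 * p - 3))
       (P (p * n%:Z + 3 * p + q - 1) - P (q - 2 * p * n%:Z - 1))
         (P (3 * p - 4)) (P (3 * p - 5) - 1)) in
     let D1 := \det (mx3
       (P (3 * p - 2) - 1) (P (3 * p - 3)) (P (3 * p - 4))
       (P (3 * p - 1)) (P (3 * p - 2) - 1) (P (3 * p - 3))
       (P (3 * p - 3)) (P (3 * p - 4)) (P (3 * p - 5) - 1)) in
     let N2 := \det (mx3
       (P (q + 1) * P (p * n%:Z + p - 4) - P q * P (p * n%:Z + p - 3))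
         (P (p - 4)) 0
       (P (q + 2) * P (p * n%:Z + p - 4) - P (q + 1) * P (p * n%:Z + p - 3))
         (- P (p - 3)) (P (p - 4))
       (P q * P (p * n%:Z + p - 4) - P (q - 1) * P (p * n%:Z + p - 3))
         0 (- P (p - 3))) in
     let D2 := \det (mx3
       (- P (p - 3)) (P (p - 4)) 0
       (P (p - 4)) (- P (p - 3)) (P (p - 4))
       (P (p - 4)) 0 (- P (p - 3))) in
     [/\ D1 != 0, D2 != 0 &
       (\sum_(0 <= j < n.+1)
          P (q - p * j%:Z) * Q (p * (n%:Z - 2 * j%:Z)))%:~R
       = N1%:~R / D1%:~R + (2 * N2)%:~R / D2%:~R :> rat])
  /\
  (forall (q : int) (n : nat),
     \sum_(0 <= j < n.+1) padovan (q - j%:Z) * perrin (n%:Z - 2 * j%:Z)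
     = padovan (n%:Z + q + 2) - padovan (q - 2 * n%:Z - 1)
       - 2 * (padovan (q + 1) * padovan (n%:Z - 3)
              - padovan q * padovan (n%:Z - 2))).
Proof.
split=> [p q n p0 P Q N1 D1 N2 D2|q n].
- rewrite /D1 /D2 /N1 /N2 /P /Q det_den1 det_den2 det_num2.
  rewrite -[\det _]/(num1 p _ _ _) num1_sum -cross_sumE.
  have [d1 d2] := (den1_neq0 p p0, den2_neq0 p p0).
  split=> //; rewrite sum_padovan_perrin_split rmorphD /=.
  by rewrite !rmorphM /= ![_ * _ / _]mulrAC !mulfV ?mul1r ?intr_eq0.
- have := sum_padovan_perrin_split 1 q n.
  rewrite (_ : \sum_(0 <= j < n.+1) padovan (q - 1 * j%:Z)
                 * perrin (1 * (n%:Z - 2 * j%:Z))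
    = \sum_(0 <= j < n.+1) padovan (q - j%:Z) * perrin (n%:Z - 2 * j%:Z));
    last by apply: eq_bigr => j _; rewrite !mul1r.
  move=> ->; have := num1_sum 1 q n; have := cross_sumE 1 q n.
  (* For p = 1 both denominators are units, so the undivided identities already give the formula
     over the integers. *)
  rewrite [den1 1](_ : _ = 1) // [den2 1](_ : _ = -1) //.
  rewrite /num1 det_mx3 /num2.
  rewrite [px1 1](_ : _ = 1) // [px2 1](_ : _ = 0) //.
  rewrite [padovan (3 * 1 - 3)](_ : _ = 1) // [padovan (3 * 1 - 4)](_ : _ = 0) //.
  rewrite [padovan (3 * 1 - 2)](_ : _ = 1) // [padovan (3 * 1 - 5)](_ : _ = 1) //.
  have [_ -> ->] := px_succ (1 * n%:Z).
  rewrite (_ : 1 * n%:Z + 3 * 1 + q - 1 = n%:Z + q + 2); last by ring.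
  rewrite (_ : q - 2 * 1 * n%:Z - 1 = q - 2 * n%:Z - 1); last by ring.
  rewrite -padovan_m2 /px1 mul1r => h2 h1; lia.
Qed.
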